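(* Let $\alpha\ge2$, $\beta\ge1$, and for $t>0$ let $u_t$ be a minimizer of $E_t^{\alpha,\beta}(\cdot;f)$ and $R(t)=\|Au_t-f\|_{\mathcal H}$. The forward solution path $t\mapsto Au_t$ is Lipschitz continuous on $(\delta,\infty)$ for all $\delta>0$. Hence $(Au_t)'$ exists almost everywhere in $(\delta,\infty)$, and for almost every $t\in(0,\infty)$ $$\|(Au_t)'\|_{\mathcal H}\le\frac{R(t)}{t}\le\frac{\|f\|_{\mathcal H}}{t}.$$ If (RC) holds, this can be improved to $$\|(Au_t)'\|_{\mathcal H}\le C_R\,t^{\frac{1-\alpha}{\alpha}}\quad\text{for a.e. }t\in(0,\infty),\qquad C_R:=J_{\min}^{\beta/\alpha},$$ and if also (SC) holds, to $$\|(Au_t)'\|_{\mathcal H}\le C_S\,t^{\frac{2-\alpha}{\alpha-1}}\quad\text{for a.e. }t\in(0,\infty),\qquad C_S:=s_*^{\frac1{\alpha-1}}J_{\min}^{\frac{\beta-1}{\alpha-1}}.$$ Furthermore, if $\alpha=2$ and (RC) and (SC) hold, the forward solution path is globally Lipschitz continuous on $[0,\infty)$ (with value $f$ at $t=0$).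
   Context: Setting: $\mathcal X$ is the (real) Banach space dual of a separable Banach space $\mathcal Y$; $\mathcal H$ is a real Hilbert space; $A:\mathcal X\to\mathcal H$ is bounded and linear, with adjoint $A^*:\mathcal H\to\mathcal X^*$, $\langle A^*q,u\rangle=\langle q,Au\rangle$. $J:\mathcal X\to[0,\infty]$ is convex, proper, weak$^*$ lower semi-continuous and absolutely one-homogeneous ($J(cu)=|c|J(u)$). $\mathcal N(J)=\{u:J(u)=0\}$, $\mathrm{dom}(J)=\{u:J(u)<\infty\}$, and $\partial J(u)=\{p\in\mathcal X^*: J(u)+\langle p,v-u\rangle\le J(v)\ \forall v\in\mathcal X\}$. The datum $f\in\mathcal H$ is such that any $u\in\mathcal X$ with $Au=f$ satisfies $J(u)\ne 0$. For $\alpha,\beta\ge1$, $t>0$: $E_t^{\alpha,\beta}(u;f)=\frac1\alpha\|Au-f\|_{\mathcal H}^\alpha+\frac t\beta J(u)^\beta$ for $u\in\mathcal X$. If $\alpha>1$ or $\beta>1$, the element $Au_t$ does not depend on the choice of minimizer $u_t$ of $E_t^{\alpha,\beta}(\cdot;f)$. Standing assumptions: (1) $u\mapsto\|Au\|_{\mathcal H}$ is a norm on $\mathcal N(J)$ equivalent to the restriction of $\|\cdot\|_{\mathcal X}$. (2) There is $C>0$ with $\|u-\mathcal P^A(Au)\|_{\mathcal X}\le C J(u)$ for all $u\in\mathcal X$, where $\mathcal P^A(g)$ denotes the (unique) minimizer of $\|Au-g\|_{\mathcal H}$ over $u\in\mathcal N(J)$, $g\in\mathcal H$. (3) $A$ is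 weak$^*$-to-weak continuous: $u_k\rightharpoonup^* u$ in $\mathcal X$ implies $Au_k\rightharpoonup Au$ in $\mathcal H$. (RC): there exists $u^\dagger\in\mathrm{dom}(J)$ with $Au^\dagger=f$. (SC): such a $u^\dagger$ exists for which additionally $A^*q\in\partial J(u^\dagger)$ for some $q\in\mathcal H$. $J_{\min}:=\min\{J(u):u\in\mathcal X,\ Au=f\}$ (under (RC)); $s_*:=\inf\{\|q\|_{\mathcal H}: q\in\mathcal H,\ A^*q\in\partial J(u)\text{ for some }u\in\mathrm{dom}(J)\text{ with }Au=f\}$ (under (RC) and (SC)). *)

(* Defs.v *)
From HB Require Import structures.
From mathcomp Require Import all_boot all_order all_algebra.
From mathcomp Require Import all_classical all_reals all_analysis.
Set Implicit Arguments.
Unset Strict Implicit.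
Unset Printing Implicit Defensive.
Import Order.TTheory GRing.Theory Num.Theory.
Import numFieldNormedType.Exports.
Local Open Scope classical_set_scope.
Local Open Scope ring_scope.

Definition separable_space (T : topologicalType) : Prop :=
  exists D : set T, countable D /\ dense D.

(* [X], with its norm, is the dual of [Y] through the pairing [b u y = <u, y>]:
   [b] identifies [X] isometrically with the bounded linear functionals on [Y]
   under the operator norm. The supremum is taken in the extended reals, so
   [dual_norm] also says that every [b u] is bounded. *)
Record is_dual_pairing (R : realType) (X Y : normedModType R)
    (b : X -> Y -> R) : Prop := {
  dual_linearl : forall y, linear (fun u => b u y : R^o) ;
  dual_linearr : forall u, linear (fun y => b u y : R^o) ;
  dual_norm : forall u,
    ereal_sup [set `|b u y|%:E | y in [set y | `|y| <= 1]] = `|u|%:E ;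
  dual_surj : forall p : Y -> R,
    linear (p : Y -> R^o) -> continuous p ->
    exists u, forall y, b u y = p y }.

(* [X] with the weak-star topology: the coarsest one for which all the maps
   [u |-> <u, y>] are continuous. *)
Definition weak_star (R : realType) (X Y : normedModType R)
    (b : X -> Y -> R) : topologicalType :=
  initial_topology (b : X -> {ptws Y -> R}).

Definition weak_star_cvg (R : realType) (X Y : normedModType R)
    (b : X -> Y -> R) (uk : nat -> X) (u : X) : Prop :=
  forall y, b (uk k) y @[k --> \oo] --> b u y.

(* A real Hilbert space is a complete normed module [H] with an inner product
   [ip] inducing its norm; the next two definitions use only [ip]. *)
Definition induces_norm (R : realType) (H : normedModType R)
    (ip : H -> H -> R) : Prop :=
  forall x, ip x x = `|x| ^+ 2.

Definition weak_cvg (R : realType) (H : normedModType R)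
    (ip : H -> H -> R) (xk : nat -> H) (x : H) : Prop :=
  forall q, ip q (xk k) @[k --> \oo] --> ip q x.

Definition bounded_operator (R : realType) (X H : normedModType R)
    (A : X -> H) : Prop :=
  exists M : R, forall u, `|A u| <= M * `|u|.

Definition adjoint (R : realType) (X H : normedModType R)
    (ip : H -> H -> R) (A : X -> H) (q : H) : X -> R :=
  fun u => ip q (A u).

Definition null_set (R : realType) (X : normedModType R)
    (J : X -> \bar R) : set X :=
  [set u | J u = 0%E].

Definition dom (R : realType) (X : normedModType R)
    (J : X -> \bar R) : set X :=
  [set u | (J u < +oo)%E].

(* The convention [0 * +oo = 0] is used in [reg_convex] at [l = 0, 1] and in
   [reg_homogeneous] at [c = 0], where it gives [J 0 = 0]. *)
Record regularizer (R : realType) (X Y : normedModType R)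
    (b : X -> Y -> R) (J : X -> \bar R) : Prop := {
  reg_ge0 : forall u : X, (0 <= J u)%E ;
  reg_convex : forall (l : R) (u v : X), 0 <= l <= 1 ->
    (J (l *: u + (1 - l) *: v)%R <= l%:E * J u + (1 - l)%R%:E * J v)%E ;
  reg_proper : dom J !=set0 ;
  reg_weak_star_lsc : lower_semicontinuous (J : weak_star b -> \bar R) ;
  reg_homogeneous : forall (c : R) (u : X), J (c *: u) = (`|c|%:E * J u)%E }.

Definition subdifferential (R : realType) (X : normedModType R)
    (J : X -> \bar R) (u : X) : set (X -> R) :=
  [set p | [/\ linear (p : X -> R^o), continuous p &
    forall v, (J u + (p (v - u))%:E <= J v)%E]].

Definition energy (R : realType) (X H : normedModType R) (A : X -> H)
    (J : X -> \bar R) (f : H) (alpha beta t : R) (u : X) : \bar R :=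
  ((alpha^-1 * `|A u - f| `^ alpha)%:E + (t / beta)%:E * poweR (J u) beta)%E.

Definition is_minimizer (R : realType) (X : Type)
    (E : X -> \bar R) (u : X) : Prop :=
  forall v, (E u <= E v)%E.

(* [u |-> |A u|] is a seminorm since [A] is linear; the lower bound makes it
   definite on the null set of [J]. *)
Definition equivalent_norm_on_null_set (R : realType) (X H : normedModType R)
    (A : X -> H) (J : X -> \bar R) : Prop :=
  exists c C : R, [/\ 0 < c, 0 < C & forall u, null_set J u ->
    c * `|u| <= `|A u| /\ `|A u| <= C * `|u|].

(* [proj_null A J g] is the minimizer of [|A u - g|] over the null set of [J];
   it exists and is unique under [equivalent_norm_on_null_set A J]. *)
Definition proj_null (R : realType) (X H : normedModType R)
    (A : X -> H) (J : X -> \bar R) (g : H) : X :=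
  get [set w | null_set J w /\
    forall v, null_set J v -> `|A w - g| <= `|A v - g|].

Definition coercive_off_null_set (R : realType) (X H : normedModType R)
    (A : X -> H) (J : X -> \bar R) : Prop :=
  exists2 C : R, 0 < C &
    forall u, (`|u - proj_null A J (A u)|%:E <= C%:E * J u)%E.

Definition weak_star_to_weak_continuous (R : realType)
    (X Y H : normedModType R) (b : X -> Y -> R) (ip : H -> H -> R)
    (A : X -> H) : Prop :=
  forall (uk : nat -> X) (u : X),
    weak_star_cvg b uk u -> weak_cvg ip (A \o uk) (A u).

Definition RC (R : realType) (X H : normedModType R)
    (A : X -> H) (J : X -> \bar R) (f : H) : Prop :=
  exists u, dom J u /\ A u = f.

Definition SC (R : realType) (X H : normedModType R) (ip : H -> H -> R)
    (A : X -> H) (J : X -> \bar R) (f : H) : Prop :=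
  exists u, [/\ dom J u, A u = f &
    exists q, subdifferential J u (adjoint ip A q)].

(* Under [RC] and the standing assumptions this infimum is finite and attained,
   so it is the minimal value of [J] among the solutions of [A u = f]. *)
Definition Jmin (R : realType) (X H : normedModType R)
    (A : X -> H) (J : X -> \bar R) (f : H) : R :=
  fine (ereal_inf [set J u | u in [set u | A u = f]]).

Definition sstar (R : realType) (X H : normedModType R) (ip : H -> H -> R)
    (A : X -> H) (J : X -> \bar R) (f : H) : R :=
  inf [set `|q| | q in [set q | exists u,
    [/\ dom J u, A u = f & subdifferential J u (adjoint ip A q)]]].

(* Main.v *)
Require Import Defs.
From HB Require Import structures.
From mathcomp Require Import all_boot all_order all_algebra.
From mathcomp Require Import all_classical all_reals all_analysis.
From mathcomp Require Import measurable_realfun ring lra.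
Set Implicit Arguments.
Unset Strict Implicit.
Unset Printing Implicit Defensive.
Import Order.TTheory GRing.Theory Num.Theory.
Import numFieldNormedType.Exports.
Local Open Scope classical_set_scope.
Local Open Scope ring_scope.

(** Two independent facts carry the theorem.

    The first is variational. Write [w_t = A u_t - f] and [R t = |w_t|].
    Minimality of [u_t], tested along segments, gives for every [z] with
    [J z] finite
      [t / beta * (J u_t ^ beta - J z ^ beta)
         <= |w_t| ^ (alpha - 2) * <w_t, A z - A u_t>]
    ([minimizer_variational]). Taking [z = u_s] in the inequality at [t] and
    [z = u_t] in the one at [s], and dividing by [t] and [s], the penalties
    cancel in the sum and what is left is a monotonicity relation between
    [w_s] and [w_t]. As [R] is nondecreasing and
    [alpha >= 2], the weight at the larger time dominates the one at the
    smaller time, both can be replaced by the latter, and Cauchy-Schwarz gives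
      [|A u_t - A u_s| <= (t - s) * R s / s] for [0 < s < t]
    ([minimizer_increment]). With [R <= |f|] this is the Lipschitz estimate on
    every half-line, and wherever the path is differentiable it bounds the
    derivative by [R t / t]. The other bounds are bounds on [R]: for [z] a
    solution of [A z = f] the variational inequality reads
      [R t ^ alpha <= t / beta * (J z ^ beta - J u_t ^ beta)],
    whose right-hand side is at most [t * J z ^ beta], and the infimum over [z]
    gives [t * Jmin ^ beta] ([residual_le_Jmin]); if moreover [A^* q] is a subgradient of [J] at [z],
    then [J z - J u_t <= |q| * R t], and the tangent inequality for the power
    [beta] lets one factor [R t] be divided out ([residual_le_source]).

    The second is that a Lipschitz curve [w] in a Hilbert space is
    differentiable almost everywhere ([lipschitz_derivable_ae]). A real
    1-Lipschitz function is the integral of a density bounded by 1, because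
    the Stieltjes measures of [(t + g t) / 2] and [(t - g t) / 2] add up to
    the Lebesgue measure, so that Radon-Nikodym applies
    ([lipschitz_density]). Apply this to the coordinates [<e_n, w>], where
    [e_n] runs over the directions of the chords of [w] between rational
    times, and let [s] be the supremum of the absolute values of the
    densities. These directions are norming, hence the increments of [w] are
    bounded by the integral of [s]. At a common Lebesgue point [t], the
    difference quotients of [w] thus have norm at most [s t] up to a small
    error, while their component along a suitable [e_n] is close to [s t] or
    to [- s t]. By the parallelogram law such vectors are close to each other:
    the quotients are Cauchy, and they converge since the space is complete. *)

(** * Power functions *)

(** Young's inequality for [y] and [x ^ (p - 1)], with the exponents [p] and
    [p / (p - 1)], rearranged. *)
Lemma powR_tangent (R : realType) (p x y : R) : 1 <= p -> 0 <= x -> 0 <= y ->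
  x `^ p - y `^ p <= p * x `^ (p - 1) * (x - y).
Proof.
rewrite le_eqVlt => /predU1P[<- x0 y0|p1 x0 y0].
  by rewrite subrr powRr0 !powRr1// !mul1r.
pose q := p / (p - 1).
have p0 : 0 < p by lra.
have q0 : 0 < q by rewrite divr_gt0 ?subr_gt0.
have pq : p^-1 + q^-1 = 1 by rewrite /q; field; lra.
have := conjugate_powR y0 (powR_ge0 x (p - 1)) p0 q0 pq.
rewrite -powRrM (_ : (p - 1) * q = p); last by rewrite /q; field; lra.
rewrite (_ : q^-1 = 1 - p^-1); last by rewrite -pq; ring.
have xx := mulr_powRB1 x0 p0.
rewrite -(ler_pM2l p0) => h.
have e : p * (y `^ p / p + x `^ p * (1 - p^-1)) = y `^ p + (p - 1) * x `^ p.
  by field; lra.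
rewrite e in h.
have -> : p * x `^ (p - 1) * (x - y) = p * (x * x `^ (p - 1)) - p * (y * x `^ (p - 1)).
  by ring.
by rewrite xx; move: h; clear; lra.
Qed.

Lemma powR_convex (R : realType) (p l x y : R) : 1 <= p -> 0 <= x -> 0 <= y ->
  0 <= l <= 1 ->
  (l * x + (1 - l) * y) `^ p <= l * x `^ p + (1 - l) * y `^ p.
Proof.
move=> p1 x0 y0 /andP[l0 l1].
set m := l * x + _.
have m0 : 0 <= m by rewrite addr_ge0 ?mulr_ge0 ?subr_ge0.
have hx := powR_tangent p1 m0 x0; have hy := powR_tangent p1 m0 y0.
have h1 := ler_wpM2l l0 hx.
have l2 : 0 <= 1 - l by rewrite subr_ge0.
have h2 := ler_wpM2l l2 hy.
have := lerD h1 h2.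
have -> : l * (p * m `^ (p - 1) * (m - x)) +
    (1 - l) * (p * m `^ (p - 1) * (m - y)) = 0 by rewrite /m; ring.
by clear; lra.
Qed.

Lemma powR_root (R : realType) (a r c : R) : 0 <= r -> 0 < a -> 0 <= c ->
  r `^ a <= c -> r <= c `^ a^-1.
Proof.
move=> r0 a0 c0 h.
rewrite -[leLHS](powRr1 r0) -(divff (lt0r_neq0 a0)) powRrM.
by apply: ge0_ler_powR; rewrite ?nnegrE ?powR_ge0 ?invr_ge0 ?(ltW a0).
Qed.

(** * Inner products *)

Lemma ip_sym (R : realType) (H : normedModType R) (ip : {dot H for idfun})
  (x y : H) : ip x y = ip y x.
Proof. by rewrite hermC expr0 mul1r. Qed.

Lemma ip_scalel (R : realType) (H : normedModType R) (ip : {dot H for idfun})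
  (c : R) (x y : H) : ip (c *: x) y = c * ip x y.
Proof. exact: linearZl_LR. Qed.

Lemma ip_scaler (R : realType) (H : normedModType R) (ip : {dot H for idfun})
  (c : R) (x y : H) : ip x (c *: y) = c * ip x y.
Proof. by rewrite ip_sym ip_scalel ip_sym. Qed.

Lemma ip_subr (R : realType) (H : normedModType R) (ip : {dot H for idfun})
  (x y z : H) : ip x (y - z) = ip x y - ip x z.
Proof. exact: linearBr. Qed.

Lemma ip_oppr (R : realType) (H : normedModType R) (ip : {dot H for idfun})
  (x y : H) : ip x (- y) = - ip x y.
Proof. exact: linearNr. Qed.

Lemma ip_normD (R : realType) (H : normedModType R) (ip : {dot H for idfun})
  (x y : H) : induces_norm ip ->
  `|x + y| ^+ 2 = `|x| ^+ 2 + 2 * ip x y + `|y| ^+ 2.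
Proof.
move=> ipn; rewrite -!ipn linearDl 2!linearDr /= (ip_sym ip y x); ring.
Qed.

Lemma ip_normB (R : realType) (H : normedModType R) (ip : {dot H for idfun})
  (x y : H) : induces_norm ip ->
  `|x - y| ^+ 2 = `|x| ^+ 2 - 2 * ip x y + `|y| ^+ 2.
Proof. by move=> ipn; rewrite (ip_normD _ _ ipn) normrN linearNr /= mulrN. Qed.

Lemma ip_Cauchy_Schwarz (R : realType) (H : normedModType R)
  (ip : {dot H for idfun}) (x y : H) : induces_norm ip ->
  `|ip x y| <= `|x| * `|y|.
Proof.
move=> ipn.
have [->|x0] := eqVneq x 0; first by rewrite linear0l !normr0 mul0r.
have [->|y0] := eqVneq y 0; first by rewrite linear0r !normr0 mulr0.
have xp : 0 < `|x| by rewrite normr_gt0.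
have yp : 0 < `|y| by rewrite normr_gt0.
have h1 : 0 <= `| `|y| *: x + `|x| *: y| ^+ 2 by rewrite exprn_ge0.
have h2 : 0 <= `| `|y| *: x - `|x| *: y| ^+ 2 by rewrite exprn_ge0.
move: h1 h2; rewrite (ip_normD _ _ ipn) (ip_normB _ _ ipn) !normrZ !normr_id.
rewrite ip_scaler ip_scalel => h1 h2.
have xy : 0 < `|x| * `|y| by rewrite mulr_gt0.
rewrite ler_norml; apply/andP; split; rewrite -(ler_pM2l xy); nra.
Qed.

(** The ball of radius [c + eta] meets the slab of vectors whose component along
    [e] is within [eta] of a number [g] of absolute value at least [c - eta]
    in a set whose diameter tends to 0 with [eta]: the midpoint of two such
    vectors also has norm at least [c - 2 * eta], and the parallelogram law
    leaves no room for their difference. *)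
Lemma uniform_convexity_slab (R : realType) (H : normedModType R)
    (ip : {dot H for idfun}) (e x y : H) (c g eta : R) :
  induces_norm ip -> `|e| <= 1 -> 0 <= c <= 1 -> 0 <= eta <= 1 ->
  c - eta <= `|g| -> `|x| <= c + eta -> `|y| <= c + eta ->
  `|ip e x - g| <= eta -> `|ip e y - g| <= eta ->
  `|x - y| ^+ 2 <= 36 * eta.
Proof.
move=> ipn e1 /andP[c0 c1] /andP[n0 n1] gc xc yc xg yg.
have s : 2 * c - 4 * eta <= `|x + y|.
  have h1 : `|ip e (x + y)| <= `|x + y|.
    apply: le_trans (ip_Cauchy_Schwarz _ _ ipn) _.
    by rewrite ler_piMl.
  apply: le_trans h1; rewrite linearDr /=.
  have : `|2 * g| <= `|ip e x + ip e y| + `|ip e x - g| + `|ip e y - g|.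
    rewrite (_ : 2 * g = (ip e x + ip e y) - (ip e x - g) - (ip e y - g)); last by ring.
    apply: le_trans (ler_normB _ _) _; rewrite lerD2r; exact: ler_normB.
  by rewrite normrM normr_nat; lra.
have x2 : `|x| ^+ 2 <= (c + eta) ^+ 2 by rewrite lerXn2r ?nnegrE ?addr_ge0.
have y2 : `|y| ^+ 2 <= (c + eta) ^+ 2 by rewrite lerXn2r ?nnegrE ?addr_ge0.
have par : `|x - y| ^+ 2 = 2 * `|x| ^+ 2 + 2 * `|y| ^+ 2 - `|x + y| ^+ 2.
  by rewrite (ip_normD x y ipn) (ip_normB x y ipn); ring.
rewrite par; have := normr_ge0 (x + y).
move: s x2 y2; generalize (`|x + y|) (`|x| ^+ 2) (`|y| ^+ 2) => s X Y.
case: (lerP 0 (2 * c - 4 * eta)) => hs s1 x2 y2 s0; last by nra.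
have : (2 * c - 4 * eta) ^+ 2 <= s ^+ 2 by rewrite lerXn2r ?nnegrE.
nra.
Qed.

(** [powR_tangent] for the power [alpha / 2] of the squared norm. The weight is
    taken at the displaced point [a + l *: d], since the
    increment of a convex function is bounded from above by the slope at the
    far end. *)
Lemma norm_powR_tangent (R : realType) (H : normedModType R)
    (ip : {dot H for idfun}) (alpha l : R) (a d : H) :
  induces_norm ip -> 2 <= alpha ->
  `|a + l *: d| `^ alpha - `|a| `^ alpha <=
  alpha * `|a + l *: d| `^ (alpha - 2) * (l * ip a d + l ^+ 2 * `|d| ^+ 2 / 2).
Proof.
move=> ipn alpha2.
have sq (x : H) r : `|x| `^ r = (`|x| ^+ 2) `^ (r / 2).
  by rewrite -powR_mulrn// -powRrM; congr (_ `^ _); field.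
rewrite !(sq _ alpha) (sq _ (alpha - 2)).
have := @powR_tangent R (alpha / 2) (`|a + l *: d| ^+ 2) (`|a| ^+ 2).
rewrite !exprn_ge0// => /(_ ltac:(lra) isT isT).
rewrite (_ : alpha / 2 - 1 = (alpha - 2) / 2); last by field.
move=> h; apply: le_trans h _.
rewrite {2}(ip_normD _ _ ipn) ip_scaler normrZ exprMn real_normK ?num_real//.
by rewrite le_eqVlt; apply/orP; left; apply/eqP; field.
Qed.

Lemma powR_norm_cvg (R : realType) (H : normedModType R) (r : R) (a d : H) :
  0 <= r -> a != 0 -> `|a + l *: d| `^ r @[l --> 0^'+] --> `|a| `^ r.
Proof.
move=> r0 a0.
have cn : `|a + l *: d| @[l --> 0^'+] --> `|a|.
  apply: cvg_norm; rewrite -[X in _ --> X]addr0.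
  apply: cvgD; first exact: cvg_cst.
  rewrite -[X in _ --> X](scale0r d).
  apply: cvgZr_tmp; apply: cvg_at_right_filter; exact: cvg_id.
have : {for `|a|, continuous (@powR R ^~ r)}.
  apply: differentiable_continuous; apply/derivable1_diffP.
  by apply: derivable_powR; rewrite in_itv/= andbT normr_gt0.
move=> cp; exact: (cvg_comp _ _ cn cp).
Qed.

(** * Densities of Lipschitz functions *)

Lemma lebesgue_stieltjes_ocitv (R : realType) (h : cumulative R R) (x y : R) :
  x <= y -> lebesgue_stieltjes_measure h `]x, y]%classic = (h y - h x)%:E.
Proof.
move=> xy; rewrite /lebesgue_stieltjes_measure /= /measure_extension.
rewrite measurable_mu_extE/=; last exact: is_ocitv.
by rewrite wlength_itv_bnd.
Qed.

(** The two Stieltjes measures add up to the Lebesgue measure, since they do on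
    half-open intervals. *)
Lemma lebesgue_stieltjes_le_lebesgue (R : realType) (h k : cumulative R R) :
  (forall t, h t + k t = t) -> forall A, measurable A ->
  (lebesgue_stieltjes_measure h A <= @lebesgue_measure R A)%E.
Proof.
move=> hk A mA.
pose m := measure_add (lebesgue_stieltjes_measure h) (lebesgue_stieltjes_measure k).
have -> : @lebesgue_measure R A = m A.
  apply: (@lebesgue_stieltjes_measure_unique R idfun) => // X /ocitvP[->|[x xlt ->]].
    by rewrite !measure0.
  rewrite lebesgue_stieltjes_ocitv ?(ltW xlt)// /m [RHS]measure_addE.
  have hE := lebesgue_stieltjes_ocitv h (ltW xlt).
  have kE := lebesgue_stieltjes_ocitv k (ltW xlt).
  transitivity ((h x.2 - h x.1)%:E + (k x.2 - k x.1)%:E)%E; last first.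
    exact: (esym (congr2 _ hE kE)).
  rewrite -EFinD; congr (_%:E).
  rewrite -[in LHS](hk x.2) -[in LHS](hk x.1) /=; ring.
rewrite /m measure_addE leeDl //.
Qed.

Lemma cumulative_half_sum (R : realType) (g : R -> R) :
  (forall x y, `|g x - g y| <= `|x - y|) ->
  exists h : cumulative R R, forall t, h t = (t + g t) / 2.
Proof.
move=> lip.
pose f t := (t + g t) / 2.
have nd : nondecreasing f.
  move=> x y xy; rewrite /f ler_pM2r ?invr_gt0//.
  have := lip x y; rewrite (distrC x y) (ger0_norm (_ : 0 <= y - x)) ?subr_ge0//.
  by rewrite ler_norml => /andP[_]; lra.
have cf : continuous f.
  move=> x; apply: cvgMr_tmp; apply: cvgD; first exact: cvg_id.
  apply/cvgrPdist_lt => e e0; near=> y.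
  apply: le_lt_trans (lip x y) _; near: y.
  exact: (@cvgr_dist_lt _ R^o _ _ _ id x).
pose F : cumulative R R :=
  HB.pack_for (cumulative R R) f (isCumulative.Build R _ R f nd (right_continuousW cf)).
by exists F.
Unshelve. all: by end_near. Qed.

Lemma Rintegral_quotient_cvg (R : realType) (q : R -> R) (a : R) :
  (forall y, lebesgue_measure.-integrable `]a, y] (EFin \o q)) ->
  locally_integrable setT q ->
  {ae lebesgue_measure, forall t, a < t ->
    h^-1 * (\int[lebesgue_measure]_(s in `]a, t + h]) q s -
            \int[lebesgue_measure]_(s in `]a, t]) q s) @[h --> 0^'] --> q t}.
Proof.
move=> qint qloc; have := @FTC1 R q (BRight a) qint qloc.
apply: filterS; first exact: (ae_filter_ringOfSetsType lebesgue_measure).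
move=> t + at_; rewrite lte_fin => /(_ at_)[dF <-].
rewrite derive1E; apply: cvg_trans dF; apply: near_eq_cvg; near=> h.
by rewrite /= /GRing.scale/= mulr1 (addrC t).
Unshelve. all: by end_near. Qed.

(** The Stieltjes measure of [h], restricted to a bounded interval to make it
    finite, is dominated by the Lebesgue measure; [q] is its Radon-Nikodym
    derivative. *)
Lemma cumulative_density (R : realType) (h k : cumulative R R) (a b : R) :
  (forall t, h t + k t = t) ->
  exists q : R -> R,
    lebesgue_measure.-integrable setT (EFin \o q) /\
    forall x y, a <= x -> x <= y -> y <= b ->
      h y - h x = \int[lebesgue_measure]_(t in `]x, y]) q t.
Proof.
move=> hk.
have mab : measurable (`]a, b]%classic : set (measurableTypeR R)).
  exact: measurable_itv.
have hle := lebesgue_stieltjes_le_lebesgue hk.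
have fin : (lebesgue_stieltjes_measure h `]a, b]%classic < +oo)%E.
  apply: le_lt_trans (hle _ mab) _.
  by rewrite lebesgue_measure_itv/=; case: ifP => _; rewrite ?ltry// -EFinB ltry.
pose nu : {finite_measure set (measurableTypeR R) -> \bar R} :=
  mfrestr mab fin.
have dom : nu `<< (@lebesgue_measure R).
  apply/null_content_dominatesP => A mA A0.
  apply/eqP; rewrite -measure_le0 -A0 /nu /= /mfrestr /mrestr.
  apply: le_trans (measureIl _ _ _) (hle _ mA) => //.
have [q [_ qfin qint qE]] := radon_nikodym_sigma_finite dom.
have fq : EFin \o (fine \o q) = q by apply/funext => t /=; rewrite fineK.
exists (fine \o q); split; first by rewrite fq.
move=> x y ax xy yb.
apply: EFin_inj.
have mxy : measurable (`]x, y]%classic : set (measurableTypeR R)).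
  exact: measurable_itv.
rewrite /Rintegral (eq_integral q) => [|t _]; last by rewrite /= fineK.
rewrite -qE// /nu /= /mfrestr /mrestr setIidl; last first.
  move=> t /=; rewrite !in_itv/= => /andP[xt ty].
  by rewrite (le_lt_trans ax xt) (le_trans ty yb).
have hE := lebesgue_stieltjes_ocitv h xy.
by rewrite -hE fineK// hE.
Qed.

Lemma bounded_integrable_itv (R : realType) (q : R -> R) (c x y : R) :
  measurable_fun setT q -> (forall t, `|q t| <= c) ->
  lebesgue_measure.-integrable `]x, y] (EFin \o q).
Proof.
move=> mq qc; apply: measurable_bounded_integrable => //.
- rewrite /= lebesgue_measure_itv/=; case: ifP => _; rewrite ?ltry// -EFinB ltry.
- exact: measurable_funTS.
- exists c; split; first exact: num_real.
  by move=> M cM t _ /=; apply: le_trans (qc t) (ltW cM).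
Qed.

Lemma bounded_locally_integrable (R : realType) (q : R -> R) (c : R) :
  measurable_fun setT q -> (forall t, `|q t| <= c) ->
  locally_integrable setT q.
Proof.
move=> mq qc; split => //; first exact: openT.
move=> K _ cK; have mK := compact_measurable cK.
have : lebesgue_measure.-integrable K (EFin \o q).
  apply: measurable_bounded_integrable => //.
  - by exact: compact_finite_measure.
  - exact: measurable_funTS.
  - exists c; split; first exact: num_real.
    by move=> M cM t _ /=; apply: le_trans (qc t) (ltW cM).
by move=> /integrableP[].
Qed.

(** The density of [g] is [2 * p - 1], where [p] is that of [(t + g t) / 2]. It is
    truncated to [-1, 1] so that the bound holds at every point and not only
    almost everywhere; suprema of such densities then stay finite. The
    truncation changes it on a null set only, because [p] is almost everywhere
    a limit of difference quotients, which lie in [0, 1]. *)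
Lemma lipschitz_density (R : realType) (g : R -> R) (a b : R) :
  (forall x y, `|g x - g y| <= `|x - y|) ->
  exists q : R -> R, [/\ measurable_fun setT q, (forall t, `|q t| <= 1) &
    forall x y, a <= x -> x <= y -> y <= b ->
      g y - g x = \int[lebesgue_measure]_(t in `]x, y]) q t].
Proof.
move=> lip.
have [h hE] := cumulative_half_sum lip.
have lipN x y : `|(\- g) x - (\- g) y| <= `|x - y|.
  by rewrite /= -opprD normrN.
have [k kE] := cumulative_half_sum lipN.
have hk t : h t + k t = t by rewrite hE kE /=; field.
(* up to [b + 1], so that every point of the interval is an interior point *)
have [p [pint pE]] := @cumulative_density R h k a (b + 1) hk.
pose r t := 2 * p t - 1.
have mp : measurable_fun setT p by apply/measurable_EFinP; exact: measurable_int pint.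
have mr : measurable_fun setT r.
  by apply: measurable_funB => //; exact: measurable_funM.
have ploc : locally_integrable setT p by exact: open_integrable_locally openT pint.
have ip x y : lebesgue_measure.-integrable `]x, y] (EFin \o p).
  exact: integrableS pint.
have := @Rintegral_quotient_cvg R p a (ip a) ploc.
pose q t := Num.max (-1) (Num.min 1 (r t)).
have mq : measurable_fun setT q.
  apply: measurable_maxr => //; apply: measurable_minr => //.
have q1 t : `|q t| <= 1.
  by rewrite /q ler_norml le_max lexx /= ge_max ge_min lexx /= andbT; lra.
move=> ptq; exists q; split => // x y ax xy yb.
have mxy : measurable (`]x, y]%classic : set (measurableTypeR R)).
  exact: measurable_itv.
have i1 : lebesgue_measure.-integrable `]x, y] (EFin \o cst (1 : R)).
  by apply: (@bounded_integrable_itv R (cst 1) 1) => // t; rewrite /cst normr1.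
have i2p : lebesgue_measure.-integrable `]x, y] (EFin \o (fun t => 2 * p t)).
  by rewrite (_ : _ \o _ = (fun t => 2%:E * (EFin \o p) t)%E) ?integrableZl.
transitivity (\int[lebesgue_measure]_(t in `]x, y]) r t).
  rewrite /r RintegralB// RintegralZl// -pE//; last by lra.
  rewrite Rintegral_cst//= lebesgue_measure_itv/= !hE mul1r.
  case: ifPn => [_|]; first by rewrite -EFinB /=; field.
  rewrite lte_fin -leNgt => yx; have -> : x = y by apply/eqP; rewrite eq_le xy yx.
  by rewrite /= ; field.
congr fine; apply: ae_eq_integral => //.
- by apply: measurable_funTS; exact/measurable_EFinP.
- by apply: measurable_funTS; exact/measurable_EFinP.
move: ptq; apply: filterS; first exact: (ae_filter_ringOfSetsType lebesgue_measure).
move=> t + /=; rewrite in_itv/= => + /andP[xt ty].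
have at_ : a < t := le_lt_trans ax xt.
move=> /(_ at_) cv; congr (_%:E); rewrite /q.
have bnd : 0 <= p t <= 1.
  have near01 : \forall e \near 0^',
      0 <= e^-1 * (\int[lebesgue_measure]_(s in `]a, t + e]) p s -
                   \int[lebesgue_measure]_(s in `]a, t]) p s) <= 1.
    near=> e.
    have et : `|e| < t - a by near: e; apply: dnbhs0_lt; rewrite subr_gt0.
    have e1 : `|e| < 1 by near: e; apply: dnbhs0_lt.
    move: et e1; rewrite !ltr_norml => /andP[et1 et2] /andP[e1 e2].
    have e0 : e != 0 by near: e; exact: nbhs_dnbhs_neq.
    rewrite -!pE; try lra.
    have := lip (t + e) t; rewrite [in leRHS]addrC addKr !hE ler_norml.
    case: (ltgtP e 0) e0 => // e0 _.
      rewrite (ltr0_norm e0) => /andP[l1 l2].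
      apply/andP; split.
        by apply: mulr_le0; rewrite ?invr_le0 ?(ltW e0)//; lra.
      by rewrite mulrC ler_ndivrMr// mul1r; lra.
    rewrite (gtr0_norm e0) => /andP[l1 l2].
    apply/andP; split.
      by apply: mulr_ge0; rewrite ?invr_ge0 ?(ltW e0)//; lra.
    by rewrite mulrC ler_pdivrMr// mul1r; lra.
  apply/andP; split.
    by apply: (cvgr_to_ge cv); apply: filterS near01 => e /andP[].
  by apply: (cvgr_to_le cv); apply: filterS near01 => e /andP[].
have [r1 r2] : -1 <= r t /\ r t <= 1 by rewrite /r; lra.
by rewrite (min_idPr r2) (max_idPr r1).
Unshelve. all: by end_near. Qed.

Lemma sup_norm_seq (R : realType) (q : nat -> R -> R) (c : R) :
  (forall n, measurable_fun setT (q n)) -> (forall n t, `|q n t| <= c) ->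
  exists s : R -> R, [/\ measurable_fun setT s, (forall t, 0 <= s t <= c),
    (forall n t, `|q n t| <= s t) &
    (forall t e, 0 < e -> exists n, s t - e < `|q n t|)].
Proof.
move=> mq qc; pose h n t := `|q n t|.
have ub t : has_ubound (range (h ^~ t)) by exists c => _ [n _ <-]; exact: qc.
have hs t : has_sup (range (h ^~ t)) by split => //; exists (h 0%N t), 0%N.
have sE t : sups (h ^~ t) 0%N = sup (range (h ^~ t)).
  by rewrite /sups /=; congr sup; apply/seteqP; split => _ [n _ <-]; exists n.
exists (fun t => sups (h ^~ t) 0%N); split.
- apply: measurable_fun_sups => // n; exact: measurableT_comp.
- move=> t; rewrite sE; apply/andP; split.
    by apply: le_trans (normr_ge0 (q 0%N t)) _; apply: ub_le_sup => //; exists 0%N.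
  by apply: ge_sup; [case: (hs t)|move=> _ [n _ <-]; exact: qc].
- by move=> n t; rewrite sE; apply: ub_le_sup => //; exists n.
- move=> t e e0; rewrite sE.
  by have [_ [n _ <-] ?] := sup_adherent e0 (hs t); exists n.
Qed.

Lemma Rintegral_increment (R : realType) (q : R -> R) (a x y : R) :
  lebesgue_measure.-integrable `]a, y] (EFin \o q) -> a <= x -> x <= y ->
  \int[lebesgue_measure]_(t in `]a, y]) q t -
  \int[lebesgue_measure]_(t in `]a, x]) q t =
  \int[lebesgue_measure]_(t in `]x, y]) q t.
Proof. by move=> iq ax xy; rewrite Rintegral_itvB// bnd_simp. Qed.

(** * Almost everywhere differentiability of Lipschitz curves *)

(** Chords between rational times only, so that the family is countable while the
    chords are dense enough to recover all increments of a continuous [w]. *)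
Definition chord_direction (R : realType) (H : normedModType R) (w : R -> H)
    (n : nat) : H :=
  if (unpickle n : option (rat * rat)) is Some (p, q) then
    let d := w (ratr q) - w (ratr p) in `|d|^-1 *: d
  else 0.

Lemma norm_chord_direction (R : realType) (H : normedModType R) (w : R -> H) n :
  `|chord_direction w n| <= 1.
Proof.
rewrite /chord_direction; case: unpickle => [[p q]|]; last by rewrite normr0.
rewrite normrZ normfV normr_id.
have [->|d0] := eqVneq (w (ratr q) - w (ratr p)) 0; first by rewrite normr0 mulr0.
by rewrite mulVf// normr_eq0.
Qed.

(** Some direction is aligned with the given chord, so the chords at rational
    times are normed by countably many functionals. *)
Lemma chord_directionP (R : realType) (H : normedModType R)
    (ip : {dot H for idfun}) (w : R -> H) (p q : rat) : induces_norm ip ->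
  exists n, ip (chord_direction w n) (w (ratr q) - w (ratr p)) =
    `|w (ratr q) - w (ratr p)|.
Proof.
move=> ipn; exists (pickle (p, q)); rewrite /chord_direction pickleK.
rewrite ip_scalel ipn expr2.
have [->|d0] := eqVneq (w (ratr q) - w (ratr p)) 0; first by rewrite normr0 !mulr0.
by rewrite mulKf// normr_eq0.
Qed.

(** For rational end points, the norm of the increment is one of its components
    and hence an integral of some [q n]; the general case follows by
    approximation, [w] being continuous. *)
Lemma norm_increment_le_integral (R : realType) (H : normedModType R)
    (ip : {dot H for idfun}) (w : R -> H) (s : R -> R) (q : nat -> R -> R)
    (a b c : R) :
  induces_norm ip -> (forall x y, `|w x - w y| <= `|x - y|) ->
  measurable_fun setT s -> (forall t, 0 <= s t <= c) ->
  (forall n, measurable_fun setT (q n)) ->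
  (forall n t, `|q n t| <= s t) ->
  (forall n x y, a <= x -> x <= y -> y <= b ->
     ip (chord_direction w n) (w y - w x) =
       \int[lebesgue_measure]_(t in `]x, y]) q n t) ->
  forall x y, a <= x -> x <= y -> y <= b ->
    `|w y - w x| <= \int[lebesgue_measure]_(t in `]x, y]) s t.
Proof.
move=> ipn lip ms sc mq qs qE x y ax xy yb.
have s_int u v : lebesgue_measure.-integrable `]u, v] (EFin \o s).
  apply: (@bounded_integrable_itv R s c) => // t.
  by case/andP: (sc t) => s0 s1; rewrite ger0_norm.
have q_int n u v : lebesgue_measure.-integrable `]u, v] (EFin \o q n).
  apply: (@bounded_integrable_itv R (q n) c) => // t.
  by apply: le_trans (qs n t) _; case/andP: (sc t).
have Qle (p r : rat) : a <= ratr p -> (ratr p : R) <= ratr r -> ratr r <= b ->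
    `|w (ratr r) - w (ratr p)| <=
    \int[lebesgue_measure]_(t in `](ratr p), (ratr r)]) s t.
  move=> ap pr rb; have [n <-] := chord_directionP w p r ipn.
  rewrite qE//; apply: le_Rintegral => // t _.
  exact: le_trans (ler_norm _) (qs n t).
have [->|nxy] := eqVneq x y.
  by rewrite subrr normr0 Rintegral_ge0// => t _; case/andP: (sc t).
have {nxy}xlty : x < y by rewrite lt_neqAle nxy.
apply/ler_addgt0Pr => e e0.
(* rationals [p < r] within [e / 2] of the end points, inside the interval *)
have xmin : x < Num.min (x + e / 2) y by rewrite lt_min xlty ltrDl divr_gt0.
have [p] := rat_in_itvoo xmin.
rewrite in_itv/= lt_min => /and3P[xp pe py].
have maxy : Num.max (y - e / 2) (ratr p) < y.
  by rewrite gt_max py ltrBlDr ltrDl divr_gt0.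
have [r] := rat_in_itvoo maxy.
rewrite in_itv/= gt_max => /andP[/andP[re pr] ry].
have split3 : w y - w x =
    (w y - w (ratr r)) + ((w (ratr r) - w (ratr p)) + (w (ratr p) - w x)).
  by rewrite !subrKA.
rewrite split3; apply: le_trans (ler_normD _ _) _.
have h1 := lip y (ratr r); have h2 := lip (ratr p) x.
have h3 := Qle p r (ltW (le_lt_trans ax xp)) (ltW pr) (ltW (lt_le_trans ry yb)).
have h4 : \int[lebesgue_measure]_(t in `](ratr p), (ratr r)]) s t <=
    \int[lebesgue_measure]_(t in `]x, y]) s t.
  rewrite /Rintegral fine_le//.
  - exact: integrable_fin_num.
  - exact: integrable_fin_num.
  - apply: ge0_subset_integral => //.
    + by have /integrableP[] := s_int x y.
    + by move=> t _ /=; rewrite lee_fin; case/andP: (sc t).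
    + move=> t /=; rewrite !in_itv/= => /andP[pt tr].
      by rewrite (lt_trans xp pt) (le_trans tr (ltW ry)).
have h5 := ler_normD (w (ratr r) - w (ratr p)) (w (ratr p) - w x).
move: h1 h2; rewrite (ger0_norm (_ : 0 <= y - ratr r)); last by rewrite subr_ge0 ltW.
rewrite (ger0_norm (_ : 0 <= ratr p - x)); last by rewrite subr_ge0 ltW.
move=> h1 h2.
apply: le_trans (lerD h1 (le_trans h5 (lerD (le_trans h3 h4) h2))) _.
rewrite addrCA lerD2l.
by move: re pe; clear; lra.
Qed.

(** At almost every [t] the indefinite integrals of the densities [q n] and of
    their supremum [s] have the derivatives [q n t] and [s t]. There the
    difference quotients of [w] eventually lie in the sets of
    [uniform_convexity_slab], with [c = s t] and [g = q n t] for an [n] that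
    almost attains the supremum. They are therefore Cauchy. *)
Lemma lipschitz1_derivable_ae_itv (R : realType) (H : completeNormedModType R)
    (ip : {dot H for idfun}) (w : R -> H) (a b : R) :
  induces_norm ip -> (forall x y, `|w x - w y| <= `|x - y|) ->
  {ae lebesgue_measure, forall t, a < t -> t < b -> derivable w t 1}.
Proof.
move=> ipn lip.
pose e := chord_direction w.
have e1 n : `|e n| <= 1 := norm_chord_direction w n.
have lipe n x y : `|ip (e n) (w x) - ip (e n) (w y)| <= `|x - y|.
  rewrite -linearBr; apply: le_trans (ip_Cauchy_Schwarz _ _ ipn) _.
  by apply: le_trans (lip x y); rewrite ler_piMl.
have /choice[q /all_and3[mq q1 qE0]] n := lipschitz_density a b (lipe n).
have qE n x y : a <= x -> x <= y -> y <= b ->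
    ip (e n) (w y - w x) = \int[lebesgue_measure]_(t in `]x, y]) q n t.
  by move=> ax xy yb; rewrite linearBr; exact: qE0.
have [s [ms s01 qs sq]] := sup_norm_seq mq q1.
have wle := norm_increment_le_integral ipn lip ms s01 mq qs qE.
have s1 t : `|s t| <= 1 by case/andP: (s01 t) => s0 ?; rewrite ger0_norm.
have s_int u v := bounded_integrable_itv u v ms s1.
have q_int n u v := bounded_integrable_itv u v (mq n) (q1 n).
have aes := Rintegral_quotient_cvg (s_int a) (bounded_locally_integrable ms s1).
have aeq n := Rintegral_quotient_cvg (q_int n a)
  (bounded_locally_integrable (mq n) (q1 n)).
have aeF := ae_filter_ringOfSetsType (@lebesgue_measure R).
have := ae_foralln aeq; apply: filterS2 aes => t + + at_ tb.
move=> /(_ at_) cs cq0; have {cq0} cq n := cq0 n at_.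
apply/cauchy_cvgP/cauchy_ballP => d d0.
(* the slab then has squared diameter at most [36 * eta < d ^+ 2] *)
pose eta := Num.min 1 (d ^+ 2 / 72).
have eta0 : 0 < eta by rewrite lt_min ltr01 divr_gt0// exprn_gt0.
have eta1 : eta <= 1 by rewrite ge_min lexx.
have etad : eta <= d ^+ 2 / 72 by rewrite ge_min lexx orbT.
have [n nE] := sq t eta eta0.
pose Q h : H := h^-1 *: (w (t + h) - w t).
have QN : \forall h \near 0^', `|Q h| <= s t + eta /\ `|ip (e n) (Q h) - q n t| <= eta.
  near=> h.
  have h0 : h != 0 by near: h; exact: nbhs_dnbhs_neq.
  have [ha hb] : a < t + h /\ t + h < b.
    have hat : `|h| < t - a by near: h; apply: dnbhs0_lt; rewrite subr_gt0.
    have hbt : `|h| < b - t by near: h; apply: dnbhs0_lt; rewrite subr_gt0.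
    by move: hat hbt; rewrite !ltr_norml => /andP[? ?] /andP[? ?]; lra.
  have cs1 : h^-1 * (\int[lebesgue_measure]_(x in `]a, t + h]) s x -
            \int[lebesgue_measure]_(x in `]a, t]) s x) <= s t + eta.
    by near: h; apply: (cvgr_le _ cs); rewrite ltrDl.
  have cq1 : `|h^-1 * (\int[lebesgue_measure]_(x in `]a, t + h]) q n x -
            \int[lebesgue_measure]_(x in `]a, t]) q n x) - q n t| <= eta.
    near: h; have /cvgrPdist_le/(_ _ eta0) := cq n.
    by apply: filterS => z; rewrite distrC.
  split.
    apply: le_trans cs1; rewrite /Q normrZ normfV.
    case: (ltgtP h 0) h0 => // h0 _.
      have th : t + h <= t by rewrite gerDl ltW.
      rewrite (ltr0_norm h0) -opprB mulrN -mulNr invrN ler_wpM2l//.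
        by rewrite oppr_ge0 invr_le0 ltW.
      rewrite distrC Rintegral_increment//; last exact: ltW.
      by apply: wle => //; exact: ltW.
    have th : t <= t + h by rewrite lerDl ltW.
    rewrite (gtr0_norm h0) ler_wpM2l ?invr_ge0 ?(ltW h0)//.
    rewrite Rintegral_increment//; last exact: ltW.
    by apply: wle => //; exact: ltW.
  rewrite /Q ip_scaler; suff -> : ip (e n) (w (t + h) - w t) =
    \int[lebesgue_measure]_(x in `]a, t + h]) q n x -
    \int[lebesgue_measure]_(x in `]a, t]) q n x by [].
  have at' : a <= t by exact: ltW.
  rewrite -(qE n a (t + h)) ?(ltW ha) ?(ltW hb)// -(qE n a t) ?(ltW tb)//.
  by rewrite !linearBr; ring.
have QE h : Q h = h^-1 *: ((w \o shift t) (h *: 1) - w t).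
  by rewrite /Q /= /GRing.scale/= mulr1 (addrC t).
have [s0 _] : 0 <= s t /\ s t <= 1 by apply/andP.
have fin (x y : H) : `|x| <= s t + eta /\ `|ip (e n) x - q n t| <= eta ->
    `|y| <= s t + eta /\ `|ip (e n) y - q n t| <= eta -> ball x d y.
  move=> [x1 x2] [y1 y2].
  rewrite -ball_normE /ball_ /=.
  rewrite -(@ltr_pXn2r _ 2)// ?nnegrE ?(ltW d0)//.
  have := uniform_convexity_slab ipn (e1 n) (s01 t) (_ : 0 <= eta <= 1) (ltW nE)
    x1 y1 x2 y2.
  rewrite (ltW eta0) eta1 => /(_ isT) h.
  apply: le_lt_trans h _; have : 0 < d ^+ 2 by rewrite exprn_gt0.
  by move: etad; clear; lra.
near=> x y; rewrite /=.
by apply: fin; [near: x|near: y]; apply: filterS QN => h; rewrite QE.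
Unshelve. all: by end_near. Qed.

Lemma dist_maxr_le (R : realType) (x y d : R) :
  `|Num.max x d - Num.max y d| <= `|x - y|.
Proof.
have h1 := ler_norm (x - y).
have h2 := ler_norm (y - x); rewrite (distrC y) in h2.
have h3 := normr_ge0 (x - y).
by case: (leP x d) => xd; case: (leP y d) => yd; rewrite ler_norml; lra.
Qed.

(** Freezing the curve before the time [delta + 1 / n.+1] and rescaling it makes
    it 1-Lipschitz on the whole line, and countably many bounded intervals
    exhaust the half-line. *)
Lemma lipschitz_derivable_ae (R : realType) (H : completeNormedModType R)
    (ip : {dot H for idfun}) (w : R -> H) (delta L : R) :
  induces_norm ip ->
  (forall x y, delta < x -> delta < y -> `|w x - w y| <= L * `|x - y|) ->
  {ae lebesgue_measure, forall t, delta < t -> derivable w t 1}.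
Proof.
move=> ipn lip.
pose K := Num.max 1 L; have K0 : 0 < K by rewrite lt_max ltr01.
pose c (n : nat) : R := delta + n.+1%:R^-1.
have cd n : delta < c n by rewrite ltrDl invr_gt0.
pose v n t := K^-1 *: w (Num.max t (c n)).
have lipv n x y : `|v n x - v n y| <= `|x - y|.
  rewrite /v -scalerBr normrZ normfV (gtr0_norm K0) ler_pdivrMl//.
  apply: le_trans (lip _ _ _ _) _; rewrite ?lt_max ?cd ?orbT//.
  apply: ler_pM => //; [|by rewrite le_max lexx orbT|].
    rewrite leNgt; apply/negP => L0.
    have := lip (delta + 1) (delta + 2); rewrite !ltrDl ltr01 ltr0n => /(_ isT isT).
    by rewrite leNgt (lt_le_trans _ (normr_ge0 _))// nmulr_rlt0// normr_gt0; lra.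
  exact: dist_maxr_le.
have aeF := ae_filter_ringOfSetsType (@lebesgue_measure R).
have := ae_foralln (fun n => lipschitz1_derivable_ae_itv (c n) n%:R ipn (lipv n)).
apply: filterS => t dv dt.
have [n [cn tn]] : exists n, c n < t /\ t < n%:R.
  have d0 : 0 < t - delta by rewrite subr_gt0.
  have b0 : 0 <= `|t| + (t - delta)^-1 by rewrite addr_ge0 ?invr_ge0 ?(ltW d0).
  exists (Num.bound (`|t| + (t - delta)^-1)); have := archi_boundP b0.
  set n := Num.bound _ => nP; split.
    rewrite /c addrC -ltrBrDr invf_plt ?posrE ?ltr0Sn//.
    have := normr_ge0 t; rewrite -natr1; lra.
  apply: le_lt_trans (ler_norm t) (le_lt_trans _ nP).
  by rewrite lerDl invr_ge0 ltW.
have {}dv := dv n cn tn.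
apply: (@near_eq_derivable _ _ _ (fun s => K *: v n s)); last exact: derivableZ.
near=> s; rewrite /v scalerA divff ?gt_eqF// scale1r.
suff -> : Num.max s (c n) = s by [].
by apply/max_idPl/ltW; near: s; exact: lt_nbhsr.
Unshelve. all: by end_near. Qed.

Lemma derive1_norm_le (R : realType) (H : normedModType R) (w : R -> H) (t c : R) :
  derivable w t 1 -> (forall s, t < s -> `|w s - w t| <= (s - t) * c) ->
  `|w^`()%classic t| <= c.
Proof.
move=> dw wc.
have cv : `|h^-1 *: (w (h + t) - w t)| @[h --> 0^'+] --> `|w^`()%classic t|.
  apply: cvg_norm; rewrite /derive1; apply: cvg_dnbhs_at_right.
  suff : cvg (h^-1 *: (w (h + t) - w t) @[h --> 0^']) by [].
  move: dw; rewrite /derivable => dw.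
  rewrite (_ : (fun h => _) = (fun h => h^-1 *: ((w \o shift t) (h *: 1) - w t)))//.
  by apply/funext => h /=; rewrite /GRing.scale/= mulr1.
apply: (cvgr_to_le cv); near=> h.
have h0 : 0 < h by near: h; exact: nbhs_right_gt.
rewrite normrZ normfV (gtr0_norm h0) ler_pdivrMl//.
by have := wc (h + t); rewrite ltrDr addrK; apply.
Unshelve. all: by end_near. Qed.

Lemma increment_lipschitz (R : realType) (H : normedModType R) (w : R -> H)
    (A : set R) (L : R) :
  (forall s t, A s -> A t -> s < t -> `|w t - w s| <= L * (t - s)) ->
  L.-lipschitz_A w.
Proof.
move=> wL [x y] /= [Ax Ay].
have [xy|yx|->] := ltgtP x y; last by rewrite !subrr !normr0 mulr0.
  by rewrite distrC (distrC x) (gtr0_norm (_ : 0 < y - x)) ?subr_gt0//; exact: wL.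
by rewrite (gtr0_norm (_ : 0 < x - y)) ?subr_gt0//; exact: wL.
Qed.

(** * Minimizers of the energy *)

Lemma energy_fin (R : realType) (X H : normedModType R) (A : X -> H)
    (J : X -> \bar R) (f : H) (alpha beta t : R) (v : X) :
  J v \is a fin_num ->
  energy A J f alpha beta t v =
    (alpha^-1 * `|A v - f| `^ alpha + t / beta * fine (J v) `^ beta)%:E.
Proof. by move=> Jv; rewrite /energy -{1}(fineK Jv) poweR_EFin -EFinM -EFinD. Qed.

Lemma reg_fin_num (R : realType) (X Y : normedModType R) (b : X -> Y -> R)
    (J : X -> \bar R) (v : X) : regularizer b J -> dom J v -> J v \is a fin_num.
Proof. by move=> Jreg; rewrite /dom /= ge0_fin_numE ?(reg_ge0 Jreg). Qed.

Lemma reg0 (R : realType) (X Y : normedModType R) (b : X -> Y -> R)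
    (J : X -> \bar R) : regularizer b J -> J 0 = 0%E.
Proof.
by move=> Jreg; have := reg_homogeneous Jreg 0 0; rewrite scale0r normr0 mul0e.
Qed.

Lemma minimizer_dom (R : realType) (X Y H : normedModType R) (b : X -> Y -> R)
    (A : X -> H) (J : X -> \bar R) (f : H) (alpha beta t : R) (v : X) :
  regularizer b J -> 1 <= beta -> 0 < t ->
  is_minimizer (energy A J f alpha beta t) v -> dom J v.
Proof.
move=> Jreg beta1 t0 vmin.
have b0 : 0 < beta by lra.
have Ev : (energy A J f alpha beta t v < +oo)%E.
  by apply: le_lt_trans (vmin 0) _; rewrite energy_fin ?ltry// (reg0 Jreg).
rewrite /dom /= ltNge leye_eq; apply/eqP => Jv; move: Ev.
rewrite /energy Jv poweRyr ?gt_eqF//.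
by rewrite gt0_muley ?lte_fin ?divr_gt0// addey.
Qed.

(** Comparison with [u = 0], for which the energy is [|f| ^ alpha / alpha]. *)
Lemma minimizer_residual_le (R : realType) (X Y H : normedModType R)
    (b : X -> Y -> R) (A : {linear X -> H}) (J : X -> \bar R) (f : H)
    (alpha beta t : R) (v : X) :
  regularizer b J -> 0 < alpha -> 1 <= beta -> 0 < t ->
  is_minimizer (energy A J f alpha beta t) v -> `|A v - f| <= `|f|.
Proof.
move=> Jreg alpha0 beta1 t0 vmin.
have Jv := reg_fin_num Jreg (minimizer_dom Jreg beta1 t0 vmin).
have b0 : 0 < beta by lra.
have := vmin 0; rewrite !energy_fin ?(reg0 Jreg)// lee_fin linear0 sub0r normrN.
rewrite powR0 ?gt_eqF// mulr0 addr0 => h.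
have {}h : `|A v - f| `^ alpha <= `|f| `^ alpha.
  rewrite -(ler_pM2l (_ : 0 < alpha^-1)) ?invr_gt0//; apply: le_trans h.
  by rewrite lerDl mulr_ge0 ?powR_ge0// divr_ge0 ?ltW.
rewrite leNgt; apply/negP => lt.
by move: h; rewrite leNgt gt0_ltr_powR// ?nnegrE.
Qed.

(** Adding the two comparisons of [us] with [ut] shows that the penalty decreases
    with the parameter; the comparison at the parameter [s] then shows that
    the residual increases. *)
Lemma minimizer_residual_nd (R : realType) (X Y H : normedModType R)
    (b : X -> Y -> R) (A : X -> H) (J : X -> \bar R) (f : H)
    (alpha beta s t : R) (us ut : X) :
  regularizer b J -> 0 < alpha -> 1 <= beta -> 0 < s -> s < t ->
  is_minimizer (energy A J f alpha beta s) us ->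
  is_minimizer (energy A J f alpha beta t) ut ->
  `|A us - f| <= `|A ut - f|.
Proof.
move=> Jreg alpha0 beta1 s0 st smin tmin.
have t0 := lt_trans s0 st.
have Js := reg_fin_num Jreg (minimizer_dom Jreg beta1 s0 smin).
have Jt := reg_fin_num Jreg (minimizer_dom Jreg beta1 t0 tmin).
have b0 : 0 < beta by lra.
have := smin ut; have := tmin us; rewrite !energy_fin// !lee_fin.
rewrite -!mulrA.
set ks := beta^-1 * fine (J us) `^ beta; set kt := beta^-1 * fine (J ut) `^ beta.
move=> h1 h2.
have kts : kt <= ks.
  rewrite leNgt; apply/negP => lt; have : 0 < (t - s) * (kt - ks).
    by rewrite mulr_gt0 ?subr_gt0.
  by move: h1 h2; clear; lra.
have hp : `|A us - f| `^ alpha <= `|A ut - f| `^ alpha.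
  rewrite -(ler_pM2l (_ : 0 < alpha^-1)) ?invr_gt0//.
  have := ler_wpM2l (ltW s0) kts.
  by move: h2; clear; lra.
rewrite leNgt; apply/negP => lt.
by move: hp; rewrite leNgt gt0_ltr_powR// ?nnegrE.
Qed.

(** The first-order optimality condition. Compare [v] with the points
    [l *: z + (1 - l) *: v], bound [J] by convexity and the data term by its
    tangent, divide by [l] and let [l] tend to 0. *)
Lemma minimizer_variational (R : realType) (X Y H : normedModType R)
    (b : X -> Y -> R) (ip : {dot H for idfun}) (A : {linear X -> H})
    (J : X -> \bar R) (f : H) (alpha beta t : R) (v z : X) :
  induces_norm ip -> regularizer b J -> 2 <= alpha -> 1 <= beta -> 0 < t ->
  is_minimizer (energy A J f alpha beta t) v -> dom J z ->
  t / beta * (fine (J v) `^ beta - fine (J z) `^ beta) <=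
  `|A v - f| `^ (alpha - 2) * ip (A v - f) (A z - A v).
Proof.
move=> ipn Jreg alpha2 beta1 t0 vmin zdom.
have Jv := reg_fin_num Jreg (minimizer_dom Jreg beta1 t0 vmin).
have Jz := reg_fin_num Jreg zdom.
have b0 : 0 < beta by lra.
have a0 : 0 < alpha by lra.
have tb : 0 < t / beta by rewrite divr_gt0.
have Jv0 : 0 <= fine (J v) by rewrite fine_ge0// (reg_ge0 Jreg).
have Jz0 : 0 <= fine (J z) by rewrite fine_ge0// (reg_ge0 Jreg).
set a := A v - f; set d := A z - A v.
set K := t / beta * _.
have key l : 0 < l -> l <= 1 ->
    K <= `|a + l *: d| `^ (alpha - 2) * (ip a d + l * (`|d| ^+ 2 / 2)).
  move=> l0 l1.
  have l01 : 0 <= l <= 1 by rewrite ltW.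
  pose y := l *: z + (1 - l) *: v.
  have Ay : A y - f = a + l *: d.
    rewrite /y linearD !linearZ /= /a /d scalerBl scale1r scalerBr.
    by rewrite addrCA addrAC.
  have Jy_le : (J y <= (l * fine (J z) + (1 - l) * fine (J v))%:E)%E.
    apply: le_trans (reg_convex Jreg _ _ l01) _.
    by rewrite -{1}(fineK Jz) -{1}(fineK Jv) -!EFinM -EFinD.
  have Jy : J y \is a fin_num.
    by apply: (reg_fin_num Jreg); apply: le_lt_trans Jy_le _; rewrite ltry.
  have Jy0 : 0 <= fine (J y) by rewrite fine_ge0// (reg_ge0 Jreg).
  have {}Jy_le : fine (J y) `^ beta <=
      l * fine (J z) `^ beta + (1 - l) * fine (J v) `^ beta.
    apply: le_trans (powR_convex beta1 Jz0 Jv0 l01).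
    rewrite -{1}(fineK Jy) lee_fin in Jy_le.
    rewrite ge0_ler_powR ?nnegrE ?(ltW b0)//.
    by rewrite addr_ge0 ?mulr_ge0 ?subr_ge0// ltW.
  have := vmin y; rewrite !energy_fin// lee_fin Ay -/a => hE.
  have hT := norm_powR_tangent l a d ipn alpha2.
  rewrite -(ler_pM2l l0).
  have hJ := ler_wpM2l (ltW tb) Jy_le.
  have {}hT : alpha^-1 * (`|a + l *: d| `^ alpha - `|a| `^ alpha) <=
      `|a + l *: d| `^ (alpha - 2) * (l * ip a d + l ^+ 2 * `|d| ^+ 2 / 2).
    by rewrite -(ler_pM2l a0) mulrA divff ?gt_eqF// mul1r mulrA.
  rewrite [leRHS](_ : _ = `|a + l *: d| `^ (alpha - 2) *
    (l * ip a d + l ^+ 2 * `|d| ^+ 2 / 2)); last by ring.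
  apply: le_trans hT; rewrite /K mulrBr.
  by move: hE hJ; clear; lra.
have cvl (c e : R) : c + l * e @[l --> 0^'+] --> c.
  rewrite -[X in _ --> X]addr0 -[X in _ --> _ + X](mul0r e).
  apply: cvgD; first exact: cvg_cst.
  by apply: cvgMr_tmp; apply: cvg_at_right_filter; exact: cvg_id.
(* at [a = 0] the tangent term vanishes, and the weight need only be bounded *)
have [az|an0] := eqVneq a 0.
  rewrite az linear0l mulr0.
  pose c := `|d| `^ (alpha - 2) * (`|d| ^+ 2 / 2).
  apply: (cvgr_to_ge (cvl 0 c)).
  near=> l.
  have l0 : 0 < l by near: l; exact: nbhs_right_gt.
  have l1 : l <= 1 by near: l; apply: nbhs_right_le.
  apply: le_trans (key l l0 l1) _.
  rewrite az linear0l !add0r normrZ (gtr0_norm l0) /c mulrCA.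
  apply: ler_wpM2l; first exact: ltW.
  apply: ler_wpM2r; first by rewrite divr_ge0 ?exprn_ge0.
  rewrite ge0_ler_powR ?nnegrE ?mulr_ge0 ?subr_ge0 ?(ltW l0)//.
  by rewrite ler_piMl.
have cv : `|a + l *: d| `^ (alpha - 2) * (ip a d + l * (`|d| ^+ 2 / 2)) @[l --> 0^'+]
    --> `|a| `^ (alpha - 2) * ip a d.
  by apply: cvgM (cvl _ _); apply: powR_norm_cvg => //; rewrite subr_ge0.
apply: (cvgr_to_ge cv); near=> l.
by apply: key; near: l; [exact: nbhs_right_gt|exact: nbhs_right_le].
Unshelve. all: by end_near. Qed.

(** The variational inequality of each minimizer is tested with the other one;
    divided by their parameters, the two add up without the penalties. With [x] and [y] the residual vectors at [t] and
    [s], [P] and [Q] the powers [alpha - 2] of their norms and [c = <x, y>],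
    the sum is [P * (|x|^2 - c) * s <= Q * (c - |y|^2) * t]. Here [|y| <= |x|]
    gives both [Q <= P] and [0 <= |x|^2 - c], so that [Q] cancels, and the rest
    is [s * |x - y|^2 <= (t - s) * <y, x - y>]. *)
Lemma minimizer_increment (R : realType) (X Y H : normedModType R)
    (b : X -> Y -> R) (ip : {dot H for idfun}) (A : {linear X -> H})
    (J : X -> \bar R) (f : H) (alpha beta s t : R) (us ut : X) :
  induces_norm ip -> regularizer b J -> 2 <= alpha -> 1 <= beta ->
  0 < s -> s < t ->
  is_minimizer (energy A J f alpha beta s) us ->
  is_minimizer (energy A J f alpha beta t) ut ->
  `|A ut - A us| <= (t - s) * (`|A us - f| / s).
Proof.
move=> ipn Jreg alpha2 beta1 s0 st smin tmin.
have t0 := lt_trans s0 st.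
have a0 : 0 < alpha by lra.
have b0 : 0 < beta by lra.
have rle : `|A us - f| <= `|A ut - f| :=
  minimizer_residual_nd Jreg a0 beta1 s0 st smin tmin.
have ds := minimizer_dom Jreg beta1 s0 smin.
have dt := minimizer_dom Jreg beta1 t0 tmin.
have := minimizer_variational ipn Jreg alpha2 beta1 s0 smin dt.
have := minimizer_variational ipn Jreg alpha2 beta1 t0 tmin ds.
set k := fine (J ut) `^ beta; set l := fine (J us) `^ beta.
have D1 : A us - A ut = (A us - f) - (A ut - f) by rewrite opprB addrA subrK.
have D2 : A ut - A us = (A ut - f) - (A us - f) by rewrite opprB addrA subrK.
rewrite D1 D2; move: rle {D1 D2}; generalize (A ut - f) (A us - f) => x y rle.
rewrite !ip_subr (ip_sym ip y x) (ipn x) (ipn y).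
have QP : `|y| `^ (alpha - 2) <= `|x| `^ (alpha - 2).
  by apply: ge0_ler_powR => //; rewrite ?nnegrE ?subr_ge0.
have nD : `|x - y| ^+ 2 = `|x| ^+ 2 - 2 * ip x y + `|y| ^+ 2 := ip_normB x y ipn.
have cs : `|ip y (x - y)| <= `|y| * `|x - y| := ip_Cauchy_Schwarz y (x - y) ipn.
have ipy : ip y (x - y) = ip x y - `|y| ^+ 2 by rewrite ip_subr (ip_sym ip y x) (ipn y).
rewrite ipy in cs.
have Q0 : 0 <= `|y| `^ (alpha - 2) := powR_ge0 _ _.
(* for [y = 0] there is no [Q] to cancel, but the sum then forces [x = 0] *)
have [y0|yn0] := eqVneq `|y| 0.
  have y00 : y = 0 by apply/eqP; rewrite -normr_eq0 y0.
  rewrite y00 (linear0r ip) normr0 !subr0 expr0n /= mul0r mulr0 sub0r.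
  move=> h1 h2; have [->|xn0] := eqVneq x 0; first by rewrite normr0.
  have xp : 0 < `|x| `^ (alpha - 2) * `|x| ^+ 2.
    by rewrite mulr_gt0 ?powR_gt0 ?exprn_gt0 ?normr_gt0.
  move: h1 h2; rewrite mulrN subrr mulr0 => h1 h2.
  have h3 : k - l < 0.
    rewrite -(pmulr_rlt0 _ (_ : 0 < t / beta)) ?divr_gt0//.
    by apply: le_lt_trans h1 _; rewrite oppr_lt0.
  have h4 : l - k <= 0.
    by rewrite -(pmulr_rle0 _ (_ : 0 < s / beta)) ?divr_gt0//.
  by exfalso; move: h3 h4; clear; lra.
have yp : 0 < `|y| by rewrite lt_neqAle eq_sym yn0 normr_ge0.
have Qp : 0 < `|y| `^ (alpha - 2) by rewrite powR_gt0.
move: nD cs QP Qp rle yp; clear -s0 st t0 b0.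
move: (normr_ge0 (x - y)).
generalize `|x - y| `|x| `|y| (ip x y) (`|y| `^ (alpha - 2)) (`|x| `^ (alpha - 2)).
move=> D X' Y' c Q P D0 nD cs QP Qp rle yp h1 h2.
have h3 : (t / beta * (k - l)) / t = - ((s / beta * (l - k)) / s) by field; lra.
have h4 : 0 <= P * (c - X' ^+ 2) / t + Q * (c - Y' ^+ 2) / s.
  have e1 : (t / beta * (k - l)) / t <= P * (c - X' ^+ 2) / t.
    by rewrite ler_pM2r ?invr_gt0.
  have e2 : (s / beta * (l - k)) / s <= Q * (c - Y' ^+ 2) / s.
    by rewrite ler_pM2r ?invr_gt0.
  by move: h3 e1 e2; clear; lra.
have {h1 h2 h3} h4 : P * (X' ^+ 2 - c) * s <= Q * (c - Y' ^+ 2) * t.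
  have := mulr_ge0 (ltW (mulr_gt0 s0 t0)) h4.
  rewrite [X in 0 <= X](_ : _ =
    P * (c - X' ^+ 2) * s + Q * (c - Y' ^+ 2) * t); last by field; lra.
  by clear; lra.
have Xc : 0 <= X' ^+ 2 - c.
  have : 0 <= D ^+ 2 by rewrite exprn_ge0.
  by move: nD (rle) yp; clear; nra.
have h5 : s * (X' ^+ 2 - c) <= t * (c - Y' ^+ 2).
  rewrite -(ler_pM2l Qp).
  have := ler_wpM2r (ltW s0) (ler_wpM2r Xc QP).
  by move: h4; clear; lra.
have h6 : c - Y' ^+ 2 <= Y' * D by apply: le_trans cs; exact: ler_norm.
have h7 : s * D ^+ 2 <= (t - s) * (Y' * D).
  apply: (@le_trans _ _ ((t - s) * (c - Y' ^+ 2))); last first.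
    by rewrite ler_wpM2l// subr_ge0 ltW.
  by rewrite nD; move: h5; clear; lra.
have [->|Dn0] := eqVneq D 0.
  by rewrite mulr_ge0 ?subr_ge0 ?divr_ge0 ?(ltW st) ?(ltW s0) ?(ltW yp).
have Dp : 0 < D by rewrite lt_neqAle eq_sym Dn0.
rewrite mulrA ler_pdivlMr// -(ler_pM2l Dp).
by move: h7; clear; lra.
Qed.

(** * Bounds on the residual *)

Lemma Jmin_ge0 (R : realType) (X Y H : normedModType R) (b : X -> Y -> R)
    (A : X -> H) (J : X -> \bar R) (f : H) :
  regularizer b J -> 0 <= Jmin A J f.
Proof.
move=> Jreg; rewrite /Jmin fine_ge0//; apply/ereal_infP => _ [v _ <-].
exact: (reg_ge0 Jreg).
Qed.

Lemma Jmin_fin (R : realType) (X Y H : normedModType R) (b : X -> Y -> R)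
    (A : X -> H) (J : X -> \bar R) (f : H) :
  regularizer b J -> RC A J f ->
  ereal_inf [set J v | v in [set v | A v = f]] = (Jmin A J f)%:E.
Proof.
move=> Jreg [v [vdom Av]]; rewrite /Jmin fineK// ge0_fin_numE.
  by apply: le_lt_trans vdom; apply: ereal_inf_lbound; exists v.
by apply/ereal_infP => _ [z _ <-]; exact: (reg_ge0 Jreg).
Qed.

Lemma sstar_ge0 (R : realType) (X H : normedModType R)
    (ip : {dot H for idfun}) (A : X -> H) (J : X -> \bar R) (f : H) :
  0 <= sstar ip A J f.
Proof.
rewrite /sstar; set S := [set _ | _ in _].
have [->|S0] := eqVneq S set0; first by rewrite inf0.
by apply: lb_le_inf; [exact/set0P|move=> _ [q _ <-]].
Qed.

(** The subgradient [A^* q] vanishes on the differences of two solutions, so [v]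
    minimizes [J] among the solutions. *)
Lemma subdifferential_Jmin (R : realType) (X H : normedModType R)
    (ip : {dot H for idfun}) (A : {linear X -> H}) (J : X -> \bar R) (f q : H)
    (v : X) :
  A v = f -> subdifferential J v (adjoint ip A q) -> Jmin A J f = fine (J v).
Proof.
move=> Av [_ _ sub]; rewrite /Jmin; congr fine; apply/eqP; rewrite eq_le.
apply/andP; split; first by apply: ereal_inf_lbound; exists v.
apply/ereal_infP => _ [z Az <-]; have := sub z.
by rewrite /adjoint linearB /= Az Av subrr linear0r adde0.
Qed.

(** [minimizer_variational] with [z] a solution of the equation: the inner
    product becomes [- |A u - f| ^ 2]. *)
Lemma residual_powR_le (R : realType) (X Y H : normedModType R)
    (b : X -> Y -> R) (ip : {dot H for idfun}) (A : {linear X -> H})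
    (J : X -> \bar R) (f : H) (alpha beta t : R) (u v : X) :
  induces_norm ip -> regularizer b J -> 2 <= alpha -> 1 <= beta -> 0 < t ->
  is_minimizer (energy A J f alpha beta t) u -> dom J v -> A v = f ->
  `|A u - f| `^ alpha <= t / beta * (fine (J v) `^ beta - fine (J u) `^ beta).
Proof.
move=> ipn Jreg alpha2 beta1 t0 umin vdom Av.
have := minimizer_variational ipn Jreg alpha2 beta1 t0 umin vdom.
rewrite Av -(opprB (A u) f) ip_oppr ipn mulrN.
have -> : `|A u - f| `^ (alpha - 2) * `|A u - f| ^+ 2 = `|A u - f| `^ alpha.
  rewrite -powR_mulrn// -powRD ?subrK//; apply/implyP => /eqP.
  by move=> h; exfalso; move: h alpha2; clear; lra.
by rewrite lerNr -mulrN opprB.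
Qed.

(** The bound holds with [J v] for every solution [v]. It is rewritten as a lower
    bound of [J v] so that it passes to the infimum. *)
Lemma residual_le_Jmin (R : realType) (X Y H : normedModType R)
    (b : X -> Y -> R) (ip : {dot H for idfun}) (A : {linear X -> H})
    (J : X -> \bar R) (f : H) (alpha beta t : R) (u : X) :
  induces_norm ip -> regularizer b J -> 2 <= alpha -> 1 <= beta -> 0 < t ->
  is_minimizer (energy A J f alpha beta t) u -> RC A J f ->
  `|A u - f| `^ alpha <= t * Jmin A J f `^ beta.
Proof.
move=> ipn Jreg alpha2 beta1 t0 umin rc.
have b0 : 0 < beta by lra.
pose c := (`|A u - f| `^ alpha / t) `^ beta^-1.
have cge0 : 0 <= `|A u - f| `^ alpha / t by rewrite divr_ge0 ?powR_ge0 ?ltW.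
have cJ : c <= Jmin A J f.
  rewrite -lee_fin -(Jmin_fin Jreg rc); apply/ereal_infP => _ [v Av <-].
  have [vdom|] := boolP (J v < +oo)%E; last first.
    by rewrite ltNge negbK => /(le_trans _); apply; rewrite leey.
  have Jv := reg_fin_num Jreg vdom.
  have Jv0 : 0 <= fine (J v) by rewrite fine_ge0// (reg_ge0 Jreg).
  rewrite -(fineK Jv) lee_fin /c.
  rewrite -[leRHS](powRr1 Jv0) -(divff (lt0r_neq0 b0)) powRrM.
  apply: ge0_ler_powR; rewrite ?nnegrE ?powR_ge0 ?invr_ge0 ?(ltW b0)//.
  rewrite ler_pdivrMr// mulrC.
  apply: le_trans (residual_powR_le ipn Jreg alpha2 beta1 t0 umin vdom Av) _.
  rewrite -mulrA ler_pM2l// -[leRHS]mul1r; apply: ler_pM.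
  - by rewrite invr_ge0 ltW.
  - have := residual_powR_le ipn Jreg alpha2 beta1 t0 umin vdom Av.
    move=> /(le_trans (powR_ge0 _ _)); rewrite pmulr_rge0// divr_gt0//.
  - by rewrite invf_le1.
  - by rewrite gerBl powR_ge0.
rewrite mulrC -ler_pdivrMr//.
rewrite -[leLHS](powRr1 cge0) -(mulVf (lt0r_neq0 b0)) powRrM.
by apply: ge0_ler_powR; rewrite ?nnegrE ?powR_ge0 ?(ltW b0) ?(Jmin_ge0 _ _ Jreg).
Qed.

(** The subgradient inequality at [u] bounds [J v - J u] by [|q| * |A u - f|]; the
    tangent inequality for the power [beta] turns this into a bound of
    [residual_powR_le] that is linear in [|A u - f|], one factor of which then
    cancels. *)
Lemma residual_le_source (R : realType) (X Y H : normedModType R)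
    (b : X -> Y -> R) (ip : {dot H for idfun}) (A : {linear X -> H})
    (J : X -> \bar R) (f q : H) (alpha beta t : R) (u v : X) :
  induces_norm ip -> regularizer b J -> 2 <= alpha -> 1 <= beta -> 0 < t ->
  is_minimizer (energy A J f alpha beta t) u -> dom J v -> A v = f ->
  subdifferential J v (adjoint ip A q) ->
  `|A u - f| `^ (alpha - 1) <= t * (Jmin A J f `^ (beta - 1) * `|q|).
Proof.
move=> ipn Jreg alpha2 beta1 t0 umin vdom Av sub.
have b0 : 0 < beta by lra.
have Jv := reg_fin_num Jreg vdom.
have Ju := reg_fin_num Jreg (minimizer_dom Jreg beta1 t0 umin).
have Jv0 : 0 <= fine (J v) by rewrite fine_ge0// (reg_ge0 Jreg).
have Ju0 : 0 <= fine (J u) by rewrite fine_ge0// (reg_ge0 Jreg).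
rewrite (subdifferential_Jmin Av sub).
have M0 : 0 <= t * (fine (J v) `^ (beta - 1) * `|q|).
  by rewrite mulr_ge0 ?(ltW t0)// mulr_ge0 ?powR_ge0.
have [r0|rn0] := eqVneq `|A u - f| 0.
  by rewrite r0 powR0// subr_eq0 gt_eqF//; lra.
have rp : 0 < `|A u - f| by rewrite lt_neqAle eq_sym rn0 normr_ge0.
rewrite -(ler_pM2l rp) mulr_powRB1//; last by lra.
apply: le_trans (residual_powR_le ipn Jreg alpha2 beta1 t0 umin vdom Av) _.
have gap : fine (J v) - fine (J u) <= `|q| * `|A u - f|.
  case: sub => _ _ /(_ u); rewrite -{1}(fineK Jv) -(fineK Ju) -EFinD lee_fin.
  rewrite /adjoint linearB /= Av => h.
  have := ler_norm (- ip q (A u - f)); rewrite normrN => h2.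
  have h3 := ip_Cauchy_Schwarz q (A u - f) ipn.
  have : - ip q (A u - f) <= `|q| * `|A u - f| by exact: le_trans h2 h3.
  by move: h; clear; lra.
have tb : 0 <= t / beta by rewrite divr_ge0 ?ltW.
apply: le_trans (ler_wpM2l tb (powR_tangent beta1 Jv0 Ju0)) _.
have w0 : 0 <= fine (J v) `^ (beta - 1) := powR_ge0 _ _.
have := ler_wpM2l (ltW t0) (ler_wpM2l w0 gap).
rewrite (_ : t / beta * _ =
  t * (fine (J v) `^ (beta - 1) * (fine (J v) - fine (J u)))); last first.
  by field; lra.
by move=> h; apply: le_trans h _; rewrite le_eqVlt; apply/orP; left; apply/eqP; ring.
Qed.

Lemma residual_le_sstar (R : realType) (X Y H : normedModType R)
    (b : X -> Y -> R) (ip : {dot H for idfun}) (A : {linear X -> H})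
    (J : X -> \bar R) (f : H) (alpha beta t : R) (u : X) :
  induces_norm ip -> regularizer b J -> 2 <= alpha -> 1 <= beta -> 0 < t ->
  is_minimizer (energy A J f alpha beta t) u -> SC ip A J f ->
  `|A u - f| `^ (alpha - 1) <= t * (Jmin A J f `^ (beta - 1) * sstar ip A J f).
Proof.
move=> ipn Jreg alpha2 beta1 t0 umin [v [vdom Av [q qsub]]].
have bnd p z := @residual_le_source R X Y H b ip A J f p alpha beta t u z
  ipn Jreg alpha2 beta1 t0 umin.
have w0 : 0 <= t * Jmin A J f `^ (beta - 1) by rewrite mulr_ge0 ?powR_ge0 ?ltW.
rewrite mulrA.
have [w00|wn0] := eqVneq (t * Jmin A J f `^ (beta - 1)) 0.
  by have := bnd _ _ vdom Av qsub; rewrite mulrA w00 !mul0r.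
have wp : 0 < t * Jmin A J f `^ (beta - 1) by rewrite lt_neqAle eq_sym wn0.
rewrite mulrC -ler_pdivrMr//; apply: lb_le_inf.
  by exists `|q|, q => //; exists v.
move=> _ [p [z [zdom Az psub]] <-].
by rewrite ler_pdivrMr// mulrC -mulrA; exact: bnd zdom Az psub.
Qed.

(** * The forward solution path *)

Theorem theorem3p6 (R : realType) (X Y H : completeNormedModType R)
    (pairing : X -> Y -> R) (ip : {dot H for idfun})
    (A : {linear X -> H}) (J : X -> \bar R) (f : H)
    (alpha beta : R) (u : R -> X)
    (Y_separable : separable_space Y)
    (X_dual : is_dual_pairing pairing)
    (ip_norm : induces_norm ip)
    (A_bounded : bounded_operator A)
    (J_reg : regularizer pairing J)
    (f_datum : forall v : X, A v = f -> J v <> 0%E)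
    (assumption1 : equivalent_norm_on_null_set A J)
    (assumption2 : coercive_off_null_set A J)
    (assumption3 : weak_star_to_weak_continuous pairing ip A)
    (alpha_ge2 : 2 <= alpha) (beta_ge1 : 1 <= beta)
    (u_min : forall t : R, 0 < t ->
      is_minimizer (energy A J f alpha beta t) (u t)) :
  let path : R -> H := fun t => A (u t) in
  let Res : R -> R := fun t => `|path t - f| in
  let mu := @lebesgue_measure R in
  [/\ (forall delta : R, 0 < delta ->
         (exists L : R, L.-lipschitz_(`]delta, +oo[) path) /\
         {ae mu, forall t : R, delta < t -> derivable path t 1}),
      {ae mu, forall t : R, 0 < t ->
         `|path^`()%classic t| <= Res t / t /\ Res t / t <= `|f| / t},
      (RC A J f ->
         let C_R := Jmin A J f `^ (beta / alpha) in
         {ae mu, forall t : R, 0 < t ->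
            `|path^`()%classic t| <= C_R * t `^ ((1 - alpha) / alpha)}),
      (RC A J f -> SC ip A J f ->
         let C_S := sstar ip A J f `^ ((alpha - 1)^-1) *
                    Jmin A J f `^ ((beta - 1) / (alpha - 1)) in
         {ae mu, forall t : R, 0 < t ->
            `|path^`()%classic t| <= C_S * t `^ ((2 - alpha) / (alpha - 1))}) &
      (alpha = 2 -> RC A J f -> SC ip A J f ->
         exists L : R,
           L.-lipschitz_(`[0, +oo[) (fun t => if t == 0 then f else path t))].
Proof.
move=> path Res mu.
have b0 : 0 < beta by lra.
have a0 : 0 < alpha by lra.
have inc s t : 0 < s -> s < t -> `|path t - path s| <= (t - s) * (Res s / s).
  move=> s0 st; exact: (minimizer_increment ip_norm J_reg alpha_ge2 beta_ge1 s0 st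
    (u_min s s0) (u_min t (lt_trans s0 st))).
have Resf t : 0 < t -> Res t <= `|f|.
  by move=> t0; exact: (minimizer_residual_le J_reg a0 beta_ge1 t0 (u_min t t0)).
have incd d s t : 0 < d -> d < s -> s < t -> `|path t - path s| <= `|f| / d * (t - s).
  move=> d0 ds st; have s0 := lt_trans d0 ds.
  apply: le_trans (inc s t s0 st) _; rewrite mulrC.
  apply: ler_wpM2r; first by rewrite subr_ge0 ltW.
  apply: ler_pM.
  - exact: normr_ge0.
  - by rewrite invr_ge0 ltW.
  - exact: Resf.
  - by rewrite lef_pV2 ?posrE// ltW.
have lipd d : 0 < d -> (`|f| / d).-lipschitz_(`]d, +oo[) path.
  move=> d0; apply: increment_lipschitz => s t /=; rewrite !in_itv/= !andbT => ds _ st.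
  exact: incd.
have der d : 0 < d -> {ae mu, forall t : R, d < t -> derivable path t 1}.
  move=> d0; apply: (@lipschitz_derivable_ae R H ip path d (`|f| / d) ip_norm).
  move=> x y dx dy; have /(_ (x, y)) := lipd d d0; apply.
  by split; rewrite /= in_itv/= ?dx ?dy.
have aeF := ae_filter_ringOfSetsType mu.
have der0 : {ae mu, forall t : R, 0 < t -> derivable path t 1}.
  have pos n : 0 < n.+1%:R^-1 :> R by rewrite invr_gt0.
  have := ae_foralln (fun n => der n.+1%:R^-1 (pos n)).
  apply: filterS => t dt t0.
  have ti : 0 <= t^-1 by rewrite invr_ge0 ltW.
  apply: (dt (Num.bound t^-1)); rewrite invf_plt ?posrE//.
  by apply: lt_le_trans (archi_boundP ti) _; rewrite ler_nat.
have dle : {ae mu, forall t : R, 0 < t -> `|path^`()%classic t| <= Res t / t}.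
  apply: filterS der0 => t dt t0; apply: derive1_norm_le; first exact: dt.
  by move=> s ts; exact: inc.
have SCle : RC A J f -> SC ip A J f -> forall t, 0 < t ->
    Res t / t <= sstar ip A J f `^ ((alpha - 1)^-1) *
      Jmin A J f `^ ((beta - 1) / (alpha - 1)) * t `^ ((2 - alpha) / (alpha - 1)).
  move=> rc sc t t0.
  have a1 : 0 < alpha - 1 by lra.
  have := residual_le_sstar ip_norm J_reg alpha_ge2 beta_ge1 t0 (u_min t t0) sc.
  have s0 := sstar_ge0 ip A J f.
  have w0 : 0 <= Jmin A J f `^ (beta - 1) := powR_ge0 _ _.
  have c0 : 0 <= t * (Jmin A J f `^ (beta - 1) * sstar ip A J f).
    by rewrite mulr_ge0 ?mulr_ge0 ?(ltW t0).
  move=> /(powR_root (normr_ge0 _) a1 c0) h.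
  rewrite ler_pdivrMr//; apply: le_trans h _.
  rewrite powRM ?mulr_ge0 ?(ltW t0)// powRM// -powRrM.
  rewrite -[X in _ <= _ * X](powRr1 (ltW t0)) -[leRHS]mulrA -powRD; last first.
    by apply/implyP => _; rewrite gt_eqF.
  rewrite (_ : (2 - alpha) / (alpha - 1) + 1 = (alpha - 1)^-1); last by field; lra.
  by rewrite le_eqVlt; apply/orP; left; apply/eqP; ring.
split.
- move=> d d0; split; last exact: der.
  by exists (`|f| / d); exact: lipd.
- apply: filterS dle => t h t0; split; first exact: h.
  by rewrite ler_pM2r ?invr_gt0//; exact: Resf.
- move=> rc C_R; apply: filterS dle => t h t0; apply: le_trans (h t0) _.
  have := residual_le_Jmin ip_norm J_reg alpha_ge2 beta_ge1 t0 (u_min t t0) rc.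
  have w0 : 0 <= Jmin A J f `^ beta := powR_ge0 _ _.
  have c0 : 0 <= t * Jmin A J f `^ beta by rewrite mulr_ge0 ?(ltW t0).
  move=> /(powR_root (normr_ge0 _) a0 c0) {}h.
  rewrite ler_pdivrMr//; apply: le_trans h _.
  rewrite powRM ?(ltW t0)// -powRrM.
  rewrite -[X in _ <= _ * X](powRr1 (ltW t0)) -[leRHS]mulrA -powRD; last first.
    by apply/implyP => _; rewrite gt_eqF.
  rewrite (_ : (1 - alpha) / alpha + 1 = alpha^-1); last by field; lra.
  by rewrite /C_R mulrC.
- move=> rc sc C_S; apply: filterS dle => t h t0; apply: le_trans (h t0) _.
  exact: SCle.
- move=> alpha2 rc sc.
  have := SCle rc sc; set C := _ * _ => Cle.
  have C1 t : 0 < t -> Res t / t <= C.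
    by move=> /Cle; rewrite alpha2 subrr mul0r powRr0 mulr1.
  exists C; apply: increment_lipschitz => s t /=; rewrite !in_itv/= !andbT => s0 _ st.
  have t0 : 0 < t := le_lt_trans s0 st.
  rewrite (gt_eqF t0); have [sz|sn0] := eqVneq s 0.
    by have := C1 t t0; rewrite sz subr0 ler_pdivrMr.
  have sp : 0 < s by rewrite lt_neqAle eq_sym sn0.
  apply: le_trans (inc s t sp st) _; rewrite mulrC.
  by apply: ler_wpM2r; [rewrite subr_ge0 ltW|exact: C1].
Qed.
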